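(* Let $E$ be a real reflexive Banach space with norm $\|\cdot\|$, and let $\Phi$ be a $C^{1}$-functional on $E$ of the form $$\Phi(u)=\frac12 a(u,u)+b(u),$$ where $a:E\times E\to\mathbb{R}$ is a continuous, symmetric, bilinear form with nonempty negative eigenspace (i.e. $\mathcal{P}^{-}=\{u\in E\mid a(u,u)<0\}$ is nonempty). Suppose that (i) $u\mapsto a(u,u)$ is weakly continuous and $b$ is weakly lower semi-continuous; (ii) $b(0)=0$, $\lim_{u\to 0}\frac{b(u)}{\|u\|^{2}}=+\infty$ and $\lim_{\|u\|\to\infty}\frac{b(u)}{\|u\|^{2}}=0$; (iii) $b'(u)u\ge b(u)>0$ for all $u\ne 0$; (iv) for every $u\neq 0$, the function $s\mapsto\frac{b'(su)u}{s}$ is non-increasing on $(0,+\infty)$. Then $\Phi$ has a critical point $\bar{u}\in\mathcal{P}^{-}$ with $$\Phi(\bar{u})=\max_{s\ge 0}\Phi(s\bar{u})=\inf_{e\in\mathcal{S}^{-}}\max_{s\ge 0}\Phi(se)=\inf_{u\in\mathcal{N}}\Phi(u)>0,$$ where $\mathcal{S}^{-}=\{u\in E\mid \|u\|=1,\ a(u,u)<0\}$ and $\mathcal{N}=\{u\in E\setminus\{0\}\mid\Phi'(u)u=0\}$.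
   Context: $\Phi'(u)\in E^*$ denotes the Fréchet derivative of $\Phi$ at $u$ and $\Phi'(u)v$ its value on $v\in E$ (similarly for $b'$; $b$ is $C^1$ since $\Phi$ and $a$ are). A critical point of $\Phi$ is a point $u\in E$ with $\Phi'(u)=0$. Weak continuity and weak lower semi-continuity are used in the sequential sense: if $u_k\rightharpoonup u$ in $E$, then $a(u_k,u_k)\to a(u,u)$ and $b(u)\le\liminf_{k\to\infty} b(u_k)$. *)

(* Defs.v *)
From HB Require Import structures.
From mathcomp Require Import all_boot all_order all_algebra.
From mathcomp Require Import sesquilinear.
From mathcomp Require Import all_classical all_reals all_analysis.

Set Implicit Arguments.
Unset Strict Implicit.
Unset Printing Implicit Defensive.

Import Order.TTheory GRing.Theory Num.Theory.
Import numFieldNormedType.Exports.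

Local Open Scope classical_set_scope.
Local Open Scope ring_scope.

Section Dual.
Context {R : realType} {E : normedModType R}.

(* E*, as a set of functions: the library has no type of continuous linear
   functionals. R^o is R seen as a module over itself. *)
Definition dual : set (E -> R^o) := [set f | linear f /\ continuous f].

(* Norm of E*. The supremum is that of a nonempty bounded set when
   f belongs to the dual. *)
Definition dual_norm (f : E -> R^o) : R :=
  sup [set `|f x| | x in [set x : E | `|x| <= 1]].

(* Elements of E**, given by functions whose values outside of the dual are
   irrelevant. *)
Definition bidual (F : (E -> R^o) -> R) : Prop :=
  (forall (k : R) (f g : E -> R^o),
      dual f -> dual g -> F (k *: f + g) = k * F f + F g) /\
  (exists C : R, forall f, dual f -> `|F f| <= C * dual_norm f).

Definition weak_cvg (u_ : nat -> E) (u : E) : Prop :=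
  forall f, dual f -> f (u_ k) @[k --> \oo] --> f u.

Definition weakly_continuous (g : E -> R) : Prop :=
  forall (u_ : nat -> E) (u : E),
    weak_cvg u_ u -> g (u_ k) @[k --> \oo] --> g u.

(* The inferior limit is taken in the extended reals, since g (u_ k) is not
   assumed to be bounded. *)
Definition weakly_lower_semicontinuous (g : E -> R) : Prop :=
  forall (u_ : nat -> E) (u : E),
    weak_cvg u_ u -> ((g u)%:E <= limn_einf (fun k => (g (u_ k))%:E))%E.

(* Continuous differentiability in the sense of Frechet: the derivative is
   continuous from E to E* for the dual norm. *)
Definition C1 (f : E -> R^o) : Prop :=
  (forall u, differentiable f u) /\
  (forall u, dual_norm (('d f v : E -> R^o) - ('d f u : E -> R^o)) @[v --> u]
               --> (0 : R)).

Definition critical_point (f : E -> R^o) (u : E) : Prop :=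
  forall v, 'd f u v = 0.

(* The filter of `|u| --> +oo. *)
Definition norm_infty : set_system E :=
  filter_from setT (fun M : R => [set u : E | M < `|u|]).

Global Instance norm_infty_filter : Filter norm_infty.
Proof.
apply: filter_from_filter; first by exists 0.
move=> M N _ _; exists (Num.max M N) => // u /=.
by rewrite gt_max => /andP[].
Qed.

End Dual.

Arguments norm_infty {R} E.

Definition reflexive_space {R : realType} (E : normedModType R) : Prop :=
  forall F : (E -> R^o) -> R, bidual F ->
    exists x : E, forall f, dual f -> F f = f x.

Section Maximum.
Context {R : realType}.

Definition maximums (A : set R) : set R := [set m | A m /\ ubound A m].

(* Meaningful only when maximums A is nonempty. *)
Definition max_value (A : set R) : R := get (maximums A).

End Maximum.

Section Functional.
Context {R : realType} {E : normedModType R}.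

Definition Pneg (a : E -> E -> R^o) : set E := [set u | a u u < 0].

Definition Sneg (a : E -> E -> R^o) : set E :=
  [set u | `|u| = 1 /\ a u u < 0].

Definition nehari (Phi : E -> R^o) : set E :=
  [set u | u <> 0 /\ 'd Phi u u = 0].

Definition ray_values (Phi : E -> R^o) (u : E) : set R :=
  [set Phi (s *: u) | s in [set s : R | 0 <= s]].

End Functional.

(* Main.v *)
(* A minimiser of Phi on the Nehari set N is found by the direct method: by (iv),
   every point of N maximises Phi on its ray, so that a minimising sequence can be
   projected on the unit sphere, where it has a weakly convergent subsequence,
   and the ray of the weak limit z does not exceed the infimum. The Nehari set
   is not a manifold, and the maximum on a ray may be reached along a segment;
   a critical point is found on the ray through the minimiser by
   deforming this ray: a path from the region Phi'(u)u > 0 to the region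
   Phi'(u)u < 0 that avoids 0 crosses N.

   The weak sequential compactness of bounded sequences (Eberlein-Smulian) is
   derived from the Hahn-Banach theorem, a minimal sublinear functional being
   linear. *)
From HB Require Import structures.
Require Import Defs.
From mathcomp Require Import all_boot all_order all_algebra.
From mathcomp Require Import sesquilinear.
From mathcomp Require Import all_classical all_reals all_analysis.
From mathcomp Require Import ring lra.
Import Order.TTheory GRing.Theory Num.Theory.
Import numFieldNormedType.Exports.
Local Open Scope classical_set_scope.
Local Open Scope ring_scope.

(** * Sublinear functionals and the Hahn-Banach theorem *)

Section HahnBanach.
Context {R : realType} {E : lmodType R}.

(** Only an inequality is asked for [t *: x], which infima inherit easily; scaling back by the
    inverse of [t] turns it into an equality. *)
Definition sublinear (q : E -> R) : Prop :=
  (forall x y, q (x + y) <= q x + q y) /\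
  (forall t x, 0 <= t -> q (t *: x) <= t * q x).

Lemma sublinear0 (q : E -> R) : sublinear q -> q 0 = 0.
Proof.
move=> [qD qZ]; apply/eqP; rewrite eq_le; apply/andP; split.
  by have := qZ 0 0 (lexx _); rewrite scale0r mul0r.
by have := qD 0 0; rewrite addr0; lra.
Qed.

Lemma sublinearZ (q : E -> R) t x : sublinear q -> 0 <= t ->
  q (t *: x) = t * q x.
Proof.
move=> sq; have [qD qZ] := sq; rewrite le_eqVlt => /predU1P[<-|t0].
  by rewrite scale0r mul0r sublinear0.
apply/eqP; rewrite eq_le (qZ _ _ (ltW t0))/= -ler_pdivlMl//.
by rewrite -{1}(scalerK (lt0r_neq0 t0) x) qZ// invr_ge0 ltW.
Qed.

Lemma sublinear_geN (q : E -> R) x : sublinear q -> - q (- x) <= q x.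
Proof.
move=> sq; have [qD _] := sq; rewrite lerNl -subr_ge0 opprK.
by rewrite -(sublinear0 _ sq) -(subrr x) addrC.
Qed.

(* If q is minimal then slope_env q x = q, while slope_env q x (- x) <= - q x:
   this forces q (- x) = - q x. *)
Definition slope_env (q : E -> R) (x y : E) : R :=
  inf [set q (y + t *: x) - t * q x | t in [set t : R | 0 <= t]].

(** Subadditivity is applied to [t *: x = - y + (y + t *: x)]. The infimum in [slope_env] is
    therefore not a default value. *)
Lemma slope_env_lbound (q : E -> R) x y : sublinear q ->
  lbound [set q (y + t *: x) - t * q x | t in [set t : R | 0 <= t]] (- q (- y)).
Proof.
move=> sq _ [t t0 <-]; have [qD _] := sq.
by have := qD (- y) (y + t *: x); rewrite addKr sublinearZ//; lra.
Qed.

Lemma slope_env_le (q : E -> R) x y t : sublinear q -> 0 <= t ->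
  slope_env q x y <= q (y + t *: x) - t * q x.
Proof.
move=> sq t0; apply: ge_inf; last by exists t.
by exists (- q (- y)); exact: slope_env_lbound.
Qed.

Lemma le_slope_env (q : E -> R) x y r :
  (forall t, 0 <= t -> r <= q (y + t *: x) - t * q x) -> r <= slope_env q x y.
Proof.
move=> h; apply: lb_le_inf => [|_ [t t0 <-]]; last exact: h.
by exists (q (y + 0 *: x) - 0 * q x); exists 0 => /=.
Qed.

(** If [t] and [s] are used for [y] and [z], then [t + s] is available for [y + z], and [l * t] for
    [l *: y]. *)
Lemma slope_env_sublinear (q : E -> R) x : sublinear q ->
  sublinear (slope_env q x).
Proof.
move=> sq; have [qD qZ] := sq; split=> [y z|l y].
  rewrite -lerBlDr; apply: le_slope_env => t t0.
  rewrite lerBlDr -lerBlDl; apply: le_slope_env => s s0; rewrite lerBlDl.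
  apply: le_trans (slope_env_le _ x (y + z) (t + s) sq (addr_ge0 t0 s0)) _.
  by have := qD (y + t *: x) (z + s *: x); rewrite addrACA -scalerDl; lra.
rewrite le_eqVlt => /predU1P[<-|l0].
  rewrite scale0r mul0r; apply: le_trans (slope_env_le _ _ _ 0 sq (lexx _)) _.
  by rewrite scale0r addr0 sublinear0// mul0r subr0.
rewrite -ler_pdivrMl//; apply: le_slope_env => t t0; rewrite ler_pdivrMl//.
apply: le_trans (slope_env_le _ _ _ (l * t) sq _) _.
  by rewrite mulr_ge0// ltW.
by rewrite -scalerA -scalerDr (sublinearZ q _ _ sq (ltW l0)) mulrBr mulrA.
Qed.

Lemma minimal_sublinear_linear (q : E -> R) : sublinear q ->
  (forall r, sublinear r -> (forall x, r x <= q x) -> r = q) ->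
  linear (q : E -> R^o).
Proof.
move=> sq qmin; have [qD qZ] := sq.
have qN x : q (- x) = - q x.
  apply/eqP; rewrite eq_le; apply/andP; split; last first.
    by have := sublinear_geN q x sq; lra.
  have <- : slope_env q x = q.
    apply: qmin; first exact: slope_env_sublinear.
    move=> y; apply: le_trans (slope_env_le _ _ _ 0 sq (lexx _)) _.
    by rewrite scale0r addr0 mul0r subr0.
  have le1 := slope_env_le q x (- x) 1 sq ler01.
  rewrite scale1r addNr sublinear0// mul1r sub0r in le1.
  apply: le_trans le1 _; rewrite lerN2.
  apply: le_trans (slope_env_le _ _ _ 0 sq (lexx _)) _.
  by rewrite scale0r addr0 mul0r subr0.
(* The reverse inequality is subadditivity for [x = (x + y) - y], combined with oddness. *)
have qadd x y : q (x + y) = q x + q y.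
  apply/eqP; rewrite eq_le qD/=.
  by have := qD (x + y) (- y); rewrite addrK qN; lra.
have qscal t x : q (t *: x) = t * q x.
  have [t0|t0] := leP 0 t; first exact: sublinearZ.
  rewrite -[t]opprK scaleNr qN sublinearZ// ?mulNr//.
  by rewrite oppr_ge0 ltW.
by move=> t x y; rewrite qadd qscal.
Qed.

(** Zorn's lemma for the reverse pointwise order on the sublinear functionals below [p]. A nonempty
    chain is bounded by its pointwise infimum, which is finite because every member is at least
    [- p (- x)] at [x]. *)
Lemma exists_minimal_sublinear (p : E -> R) : sublinear p ->
  exists q, [/\ sublinear q, (forall x, q x <= p x) &
    forall r, sublinear r -> (forall x, r x <= q x) -> r = q].
Proof.
move=> sp.
pose T := {q : E -> R | sublinear q /\ forall x, q x <= p x}.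
pose rel (q r : T) := `[< forall x, sval r x <= sval q x >].
have [|||A Atot|[q [sq qp]] qmax] := @Zorn T rel.
- by move=> q; apply/asboolP => x.
- move=> r s t /asboolP rs /asboolP st; apply/asboolP => x.
  exact: le_trans (st x) (rs x).
- move=> [s hs] [t ht] /asboolP st /asboolP ts; apply: eq_exist => /=.
  by apply/funext => x; apply/eqP; rewrite eq_le st ts.
- have [[q0 Aq0]|A0] := pselect (A !=set0); last first.
    exists (exist _ p (conj sp (fun x => lexx (p x)))) => s As.
    by case: A0; exists s.
  pose m x := inf [set sval q x | q in A].
  have lb x : lbound [set sval q x | q in A] (- p (- x)).
    move=> _ [[q [sq qp]] /= Aq <-]; have := sublinear_geN q x sq.
    by have := qp (- x); lra.
  have m_le x q : A q -> m x <= sval q x.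
    by move=> Aq; apply: ge_inf; [exists (- p (- x)); exact: lb | exists q].
  have le_inf_m x r : (forall q, A q -> r <= sval q x) -> r <= m x.
    move=> h; apply: lb_le_inf; first by exists (sval q0 x), q0.
    by move=> _ [q Aq <-]; exact: h.
  have sm : sublinear m.
    split=> [x y|t x].
      rewrite -lerBlDr; apply: (le_inf_m) => q Aq.
      rewrite lerBlDr -lerBlDl; apply: le_inf_m => r Ar; rewrite lerBlDl.
      (* A single member must serve both terms: the smaller of [q] and [r], which are comparable in
         a chain. *)
      have [/asboolP qr|/asboolP rq] := Atot q r Aq Ar.
        apply: le_trans (m_le (x + y) r Ar) _.
        apply: le_trans ((svalP r).1.1 x y) _.
        by rewrite lerD2r; exact: qr.
      apply: le_trans (m_le (x + y) q Aq) _.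
      apply: le_trans ((svalP q).1.1 x y) _.
      by rewrite lerD2l; exact: rq.
    rewrite le_eqVlt => /predU1P[<-|t0].
      rewrite scale0r mul0r; apply: le_trans (m_le 0 q0 Aq0) _.
      by rewrite (sublinear0 _ (svalP q0).1).
    rewrite -ler_pdivrMl//; apply: le_inf_m => q Aq; rewrite ler_pdivrMl//.
    rewrite -(sublinearZ _ _ _ (svalP q).1 (ltW t0)); exact: m_le.
  have mp x : m x <= p x.
    by apply: le_trans (m_le x q0 Aq0) _; exact: (svalP q0).2.
  exists (exist _ m (conj sm mp)) => q Aq; apply/asboolP => x /=; exact: m_le.
exists q; split=> // r sr rq.
have rp x : r x <= p x by exact: le_trans (rq x) (qp x).
have /(_ _)/(congr1 sval)/= := qmax (exist _ r (conj sr rp)).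
by apply; apply/asboolP.
Qed.

(** A minimal [q] below [slope_env p x0] is linear, and the choice [t = 1] in the envelope gives
    [q (- x0) <= - p x0], hence equality at [x0]. *)
Theorem hahn_banach (p : E -> R) (x0 : E) : sublinear p ->
  exists f : E -> R^o, [/\ linear f, (forall x, f x <= p x) & f x0 = p x0].
Proof.
move=> sp; have [q [sq qp qmin]] :=
  exists_minimal_sublinear _ (slope_env_sublinear _ x0 sp).
have lq := minimal_sublinear_linear q sq qmin.
have qlep x : q x <= p x.
  apply: le_trans (qp x) _; apply: le_trans (slope_env_le _ _ _ 0 sp (lexx _)) _.
  by rewrite scale0r addr0 mul0r subr0.
exists q; split=> //; apply/eqP; rewrite eq_le qlep/=.
have := le_trans (qp (- x0)) (slope_env_le _ _ _ 1 sp ler01).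
rewrite scale1r addNr sublinear0// mul1r sub0r.
have := lq (-1) x0 0; rewrite addr0 (sublinear0 _ sq) addr0 scaleN1r => ->.
by rewrite scaleN1r lerN2.
Qed.

End HahnBanach.

(** * Weak sequential compactness in reflexive spaces *)

Section WeakCompactness.
Context {R : realType} {E : normedModType R}.
Implicit Types (f g : E -> R^o) (x : nat -> E) (z : E).

Lemma linear_fun_pack {V W : lmodType R} {f : V -> W} :
  linear f -> exists fL : {linear V -> W}, fL = f :> (V -> W).
Proof.
move=> lf; pose fM := GRing.isLinear.Build _ _ _ _ _ lf.
by pose fL : {linear V -> W} := HB.pack f fM; exists fL.
Qed.

Lemma linear_funB {V W : lmodType R} {f : V -> W} : linear f ->
  {morph f : y z / y - z}.
Proof. by move=> /linear_fun_pack[fL <-] y z; exact: linearB. Qed.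

Lemma linear_funN {V W : lmodType R} {f : V -> W} : linear f ->
  {morph f : y / - y}.
Proof. by move=> /linear_fun_pack[fL <-] y; exact: linearN. Qed.

Lemma dual_boundP f : linear f ->
  continuous f <-> exists M, forall z, `|f z| <= M * `|z|.
Proof.
move=> /linear_fun_pack[fL <-]; split.
  move=> /linear_bounded_continuous/linear_boundedP.
  by move=> /pinfty_ex_gt0[M _ h]; exists M.
move=> [M h]; apply/linear_bounded_continuous/linear_boundedP; near=> r => z.
apply: le_trans (h z) _; by rewrite ler_wpM2r.
Unshelve. all: by end_near. Qed.

Lemma dual_normP f z : dual f -> `|f z| <= dual_norm f * `|z|.
Proof.
move=> [lf cf]; have [M fM] := (dual_boundP f lf).1 cf.
have [fL fE] := linear_fun_pack lf.
have [->|z0] := eqVneq z 0.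
  by rewrite -fE raddf0 !normr0 mulr0.
have nz : 0 < `|z| by rewrite normr_gt0.
have -> : `|f z| = `|f (`|z|^-1 *: z)| * `|z|.
  rewrite -fE linearZ/= normrM gtr0_norm ?invr_gt0// mulrAC mulVf ?mul1r//.
  exact: lt0r_neq0.
rewrite ler_wpM2r//; apply: ub_le_sup.
  exists `|M| => _ [y /= y1 <-]; apply: le_trans (fM y) _.
  apply: le_trans (ler_norm _) _; rewrite normrM normr_id.
  by rewrite ler_piMr.
exists (`|z|^-1 *: z) => //=.
by rewrite normrZ gtr0_norm ?invr_gt0// mulVf// lt0r_neq0.
Qed.

Lemma dual_le_norm f : linear f -> (forall z, f z <= `|z|) ->
  dual f /\ forall z, `|f z| <= `|z|.
Proof.
move=> lf fle; have [fL fE] := linear_fun_pack lf.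
have fN z : `|f z| <= `|z|.
  rewrite ler_norml fle andbT lerNl; have := fle (- z).
  by rewrite -fE raddfN normrN.
split=> //; split=> //; apply/dual_boundP => //.
by exists 1 => z; rewrite mul1r.
Qed.

Lemma norming_functional z :
  exists g, [/\ dual g, (forall y, `|g y| <= `|y|) & g z = `|z|].
Proof.
have [|g [lg gle gz]] := hahn_banach (fun y : E => `|y|) z.
  by split=> [y w|t y t0]; [exact: ler_normD | rewrite normrZ ger0_norm].
by have [dg gN] := dual_le_norm g lg gle; exists g.
Qed.

(** The map [c] lets real combinations ([id]) and rational ones ([ratr]) share one definition; the
    lists describing the latter are countable. *)
Definition lincomb (S : Type) (c : S -> R) x (s : seq (S * nat)) : E :=
  \sum_(i <- s) c i.1 *: x i.2.

(** Membership of [z] in the closed span of [x] is expressed by the vanishing of this seminorm,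
    which also serves as the dominating functional in the Hahn-Banach theorem. *)
Definition dist_span x z : R :=
  inf [set `|z - lincomb R id x s| | s in setT].

Lemma dist_span_le x z s : dist_span x z <= `|z - lincomb R id x s|.
Proof. by apply: ge_inf; [exists 0 => _ [t _ <-] | exists s]. Qed.

Lemma le_dist_span x z r :
  (forall s, r <= `|z - lincomb R id x s|) -> r <= dist_span x z.
Proof.
move=> h; apply: lb_le_inf => [|_ [s _ <-]]; last exact: h.
by exists `|z - lincomb R id x [::]|, [::].
Qed.

Lemma lincombZ x t s :
  t *: lincomb R id x s = lincomb R id x [seq (t * i.1, i.2) | i <- s].
Proof.
rewrite /lincomb big_map scaler_sumr; apply: eq_bigr => i _.
by rewrite scalerA.
Qed.

Lemma dist_span_sublinear x : sublinear (dist_span x).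
Proof.
split=> [y z|t z].
  rewrite -lerBlDr; apply: le_dist_span => s.
  rewrite lerBlDr -lerBlDl; apply: le_dist_span => r; rewrite lerBlDl.
  apply: le_trans (dist_span_le x (y + z) (s ++ r)) _.
  rewrite /lincomb big_cat/= opprD addrACA; exact: ler_normD.
rewrite le_eqVlt => /predU1P[<-|t0].
  rewrite scale0r mul0r; apply: le_trans (dist_span_le x 0 [::]) _.
  by rewrite /lincomb big_nil subr0 normr0.
rewrite -ler_pdivrMl//; apply: le_dist_span => s; rewrite ler_pdivrMl//.
apply: le_trans (dist_span_le x _ [seq (t * i.1, i.2) | i <- s]) _.
by rewrite -lincombZ -scalerBr normrZ gtr0_norm.
Qed.

(* Mazur's theorem for the closed span of a sequence. *)
Lemma dist_span_eq0 x z :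
  (forall f, dual f -> (forall n, f (x n) = 0) -> f z = 0) ->
  dist_span x z = 0.
Proof.
move=> h; have [f [lf fle fz]] := hahn_banach _ z (dist_span_sublinear x).
have [df _] : dual f /\ forall z, `|f z| <= `|z|.
  apply: dual_le_norm => // y; apply: le_trans (fle y) _.
  by have := dist_span_le x y [::]; rewrite /lincomb big_nil subr0.
rewrite -fz; apply: h => // n; apply/eqP; rewrite eq_le; apply/andP; split.
  apply: le_trans (fle _) _; apply: le_trans (dist_span_le _ _ [:: (1, n)]) _.
  by rewrite /lincomb big_seq1/= scale1r subrr normr0.
rewrite -oppr_le0 -(linear_funN lf); apply: le_trans (fle _) _.
apply: le_trans (dist_span_le _ _ [:: (-1, n)]) _.
by rewrite /lincomb big_seq1/= scaleN1r subrr normr0.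
Qed.

Lemma lincomb_rat_dense x s (e : R) : 0 < e ->
  exists r : seq (rat * nat), `|lincomb R id x s - lincomb rat ratr x r| < e.
Proof.
elim: s e => [|[t n] s IH] e e0.
  by exists [::]; rewrite /lincomb !big_nil subr0 normr0.
have e2 : 0 < e / 2 by rewrite divr_gt0.
have [r rlt] := IH _ e2.
(* The added 1 keeps the denominator positive when [x n] is 0. *)
have d0 : 0 < e / 2 / (`|x n| + 1) by rewrite divr_gt0// ltr_wpDl.
have [q] : exists q, ratr q \in `]t - e / 2 / (`|x n| + 1), t[.
  by apply: rat_in_itvoo; rewrite ltrBlDr ltrDl.
rewrite in_itv/= => /andP[q1 q2].
exists ((q, n) :: r); rewrite /lincomb !big_cons/= opprD addrACA.
apply: le_lt_trans (ler_normD _ _) _; rewrite -scalerBl normrZ.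
rewrite [e]splitr ltr_leD//; last exact: ltW.
have tq0 : 0 < t - ratr q by rewrite subr_gt0.
rewrite gtr0_norm//; apply: (@le_lt_trans _ _ ((t - ratr q) * (`|x n| + 1))).
  by rewrite ler_wpM2l ?ltW// ltrDl.
by rewrite -ltr_pdivlMr ?ltr_wpDl//; lra.
Qed.

(** The [g i] are norming functionals of the rational combinations. If they all vanish at [z] and
    [w] is such a combination close to [z], then [|w| = g (w - z) <= |w - z|] for the functional [g]
    norming [w], so that [z] is small too. *)
Lemma countable_separating_span x : exists g : nat -> E -> R^o,
  (forall i, dual (g i)) /\
  forall z, dist_span x z = 0 -> (forall i, g i z = 0) -> z = 0.
Proof.
(* Numbers that encode no list stand for the empty combination. *)
pose y i := lincomb rat ratr x (odflt [::] (unpickle i)).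
have [g gP] := choice (fun i => norming_functional (y i)).
exists g; split=> [i|z pz gz]; first by have [] := gP i.
apply/eqP; rewrite -normr_le0.
apply/ler_addgt0Pr => e e0; rewrite add0r.
have e4 : 0 < e / 4 by rewrite divr_gt0.
have hinf : has_inf [set `|z - lincomb R id x s| | s in setT].
  split; first by exists `|z - lincomb R id x [::]|, [::].
  by exists 0 => _ [t _ <-].
have [_ [s _ <-]] := inf_adherent e4 hinf.
rewrite -/(dist_span x z) pz add0r => zs.
have [r rs] := lincomb_rat_dense x s _ e4.
have [dg gle gy] := gP (pickle r); move: gle gy.
have -> : y (pickle r) = lincomb rat ratr x r by rewrite /y pickleK.
set w := lincomb rat ratr x r => gle gw.
have zw : `|z - w| < e / 2.
  have -> : z - w = (z - lincomb R id x s) + (lincomb R id x s - w).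
    by rewrite addrA subrK.
  by apply: le_lt_trans (ler_normD _ _) _; lra.
have ww : `|w| <= `|z - w|.
  have := gle (w - z); rewrite (linear_funB dg.1) gw gz subr0 normr_id.
  by rewrite distrC.
have := ler_normD (z - w) w; rewrite subrK.
by lra.
Qed.

(** The segment [[- M, M]] is compact, which gives a cluster point; an ultrafilter converges to each
    of its cluster points. *)
Lemma bounded_ultra_cvg (I : Type) (U : set_system I) (u : I -> R) (M : R) :
  UltraFilter U -> (forall i, `|u i| <= M) ->
  exists l : R, u i @[i --> U] --> l.
Proof.
move=> UU uM; have PU : ProperFilter U by exact: ultra_proper.
have [l [_ ul]] : `[- M, M] `&` cluster (u @ U) !=set0.
  apply: segment_compact.
  by apply: (@filterE _ U) => i; rewrite /= in_itv/= -ler_norml.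
exists l => A lA; have [//|UnA] := in_ultra_setVsetC (u @^-1` A) UU.
by have [r [nAr Ar]] := ul (~` A) A UnA lA; case: nAr.
Qed.

Lemma dual_norm_ge0 f : 0 <= dual_norm f.
Proof.
(* Without a finite supremum, [sup] has the default value 0. *)
rewrite /dual_norm; have [hs|/sup_out ->//] := pselect (has_sup
  [set `|f x| | x in [set x : E | `|x| <= 1]]).
apply: le_trans (normr_ge0 (f 0)) _; apply: ub_le_sup; first exact: hs.2.
by exists 0 => //=; rewrite normr0.
Qed.

(** The limit of [f (u i)] along [U] exists for each [f] of the dual, and as a function of [f] it
    belongs to the bidual, with bound [M]; reflexivity represents it by a point. *)
Lemma reflexive_ultra_cvg (I : Type) (U : set_system I) (u : I -> E) (M : R) :
  reflexive_space E -> UltraFilter U -> (forall i, `|u i| <= M) ->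
  exists z, forall f, dual f -> f (u i) @[i --> U] --> f z.
Proof.
move=> hE UU uM.
have PU : ProperFilter U by exact: ultra_proper.
have fuM f i : dual f -> `|f (u i)| <= M * dual_norm f.
  move=> df; apply: le_trans (dual_normP _ _ df) _.
  by rewrite mulrC ler_wpM2r// dual_norm_ge0.
have cvgf f : dual f -> cvg (f (u i) @[i --> U]).
  move=> df; apply/cvg_ex.
  by apply: (bounded_ultra_cvg _ U (f \o u) (M * dual_norm f)) => i; exact: fuM.
have [|z zP] := hE (fun f => lim (f (u i) @[i --> U])).
  split=> [k f g df dg|].
    apply/cvg_lim => //; apply: cvgD; last exact: cvgf.
    by apply: cvgM; [exact: cvg_cst | exact: cvgf].
  exists M => f df; have cf := cvgf f df; rewrite ler_norml; apply/andP; split.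
    apply: limr_ge => //; apply: filterE => i.
    by have := fuM f i df; rewrite ler_norml => /andP[].
  apply: limr_le => //; apply: filterE => i.
  by have := fuM f i df; rewrite ler_norml => /andP[].
by exists z => f df; rewrite -zP//; exact: cvgf.
Qed.

(* Eberlein-Smulian, without diagonal extraction: a subsequence approaching one
   weak cluster point z on countably many functionals that separate the closed
   span of x has no other weak cluster point. The map n is not required to be
   increasing. *)
Theorem reflexive_weak_subsequence x (M : R) :
  reflexive_space E -> (forall n, `|x n| <= M) ->
  exists (n : nat -> nat) z, (forall k, (k <= n k)%N) /\ weak_cvg (x \o n) z.
Proof.
move=> hE xM; have [g [dg gsep]] := countable_separating_span x.
have [U [UU oU]] := ultraFilterLemma (eventually_filter : ProperFilter \oo).
have PU : ProperFilter U by exact: ultra_proper.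
have [z zP] := reflexive_ultra_cvg _ U x M hE UU xM.
(* The index [n k] brings the first [k + 1] functionals close to their values at [z] simultaneously:
   finitely many conditions hold together along [U]. *)
have /choice[n nP] : forall k, exists n, (k <= n)%N /\
    forall i, (i <= k)%N -> `|g i z - g i (x n)| < k.+1%:R^-1.
  move=> k; have {}zP i : \forall n \near U, `|g i z - g i (x n)| < k.+1%:R^-1.
    have /cvgrPdist_lt := zP _ (dg i); apply; by rewrite invr_gt0.
  have H j : \forall n \near U, forall i, (i <= j)%N ->
      `|g i z - g i (x n)| < k.+1%:R^-1.
    elim: j => [|j IH].
      by apply: filterS (zP 0%N) => n h i; rewrite leqn0 => /eqP ->.
    apply: filterS2 IH (zP j.+1) => n h1 h2 i.
    by rewrite leq_eqVlt => /predU1P[->//|/h1].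
  have /filter_ex[n [? ?]] : U ([set n | (k <= n)%N] `&` [set n | forall i,
     (i <= k)%N -> `|g i z - g i (x n)| < k.+1%:R^-1]).
    apply: filterI; last exact: H.
    by apply: oU; exact: nbhs_infty_ge.
  by exists n.
have gz i : g i (x (n k)) @[k --> \oo] --> g i z.
  apply/cvgrPdist_lt => e e0; near=> k.
  have ik : (i <= k)%N by near: k; exact: nbhs_infty_ge.
  apply: lt_trans ((nP k).2 i ik) _.
  by near: k; exact: near_infty_natSinv_lt (PosNum e0).
exists n, z; split=> [k|f df]; first exact: (nP k).1.
apply/cvgrPdist_lt => e e0; apply: contrapT => fnz.
(* If convergence fails for [f], the indices [m K] keep a gap [e]; the sequence that they select has
   its own weak limit [z'] along [U]. *)
have /choice[m mP] : forall K, exists k, (K <= k)%N /\ e <= `|f z - f (x (n k))|.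
  move=> K; apply: contrapT => h; apply: fnz; exists K => // k /= Kk.
  by rewrite ltNge; apply/negP => ek; apply: h; exists k.
have [z' z'P] := reflexive_ultra_cvg _ U (x \o n \o m) M hE UU (fun i => xM _).
have mU : m k @[k --> U] --> \oo.
  move=> A [N _ NA]; apply: oU; exists N => // k /= Nk; apply: NA.
  exact: leq_trans Nk (mP k).1.
(* A functional vanishing on all [x n] vanishes at both limits, so [z - z'] is in the closed span;
   the [g i] agree at [z] and [z'] and separate that span. *)
have zz' : z - z' = 0.
  apply: gsep => [|i].
    apply: dist_span_eq0 => h dh hx; rewrite (linear_funB dh.1).
    have hu (v : nat -> nat) w :
        h (x (v k)) @[k --> U] --> h w -> h w = 0.
      have -> : (fun k => h (x (v k))) = cst 0 by apply/funext => k; rewrite hx.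
      by move=> h0; apply: (norm_cvg_unique h0); exact: cvg_cst.
    by rewrite (hu id z (zP _ dh)) (hu (n \o m) z' (z'P _ dh)) subr0.
  rewrite (linear_funB (dg i).1); apply/eqP; rewrite subr_eq0; apply/eqP.
  have h1 : g i (x (n (m k))) @[k --> U] --> g i z := cvg_comp _ _ mU (gz i).
  exact: norm_cvg_unique h1 (z'P _ (dg i)).
have fz := z'P f df; move/eqP: zz'; rewrite subr_eq0 => /eqP zz'.
move: fz; rewrite -zz' => /cvgrPdist_lt/(_ e e0)/filter_ex[k /=].
by rewrite ltNge (mP k).2.
Unshelve. all: by end_near. Qed.

End WeakCompactness.

(** * Differential calculus along lines, and joint continuity of the differential *)

Section C1Functionals.
Context {R : realType} {E : normedModType R}.
Implicit Types (f : E -> R^o) (u v : E).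

Lemma dual_diff f u : differentiable f u -> dual ('d f u).
Proof.
move=> df; split; last exact: diff_continuous.
by move=> k x y; rewrite linearP.
Qed.

Lemma dualB (f g : E -> R^o) : dual f -> dual g -> dual (f - g).
Proof.
move=> [lf cf] [lg cg]; split; last first.
  by move=> x; apply: cvgB; [exact: cf | exact: cg].
move=> k x y; rewrite /= !fctE lf lg scalerBr.
by rewrite opprD addrACA.
Qed.

(** Near [(u, v)] the value splits into [('d f w - 'd f u)] applied to the direction, controlled by
    the dual norm, and the continuous linear map ['d f u]. *)
Lemma C1_diff_continuous f : C1 f ->
  continuous (fun p : E * E => 'd f (p.1) (p.2) : R^o).
Proof.
move=> [df cdf] [u v].
pose D w : E -> R^o := ('d f w : E -> R^o) - ('d f u : E -> R^o).
have dD w : dual (D w) by apply: dualB; exact: dual_diff.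
have -> : (fun p : E * E => 'd f (p.1) (p.2) : R^o) =
    (fun p : E * E => D p.1 p.2 + 'd f u (p.2)).
  by apply/funext => p; rewrite /D !fctE subrK.
rewrite /continuous_at/=; have -> : D u v = 0 by rewrite /D !fctE subrr.
apply: cvgD; last first.
  apply: (@cvg_comp _ _ _ snd ('d f u) _ (nbhs v)); first exact: cvg_snd.
  exact: (dual_diff f u (df u)).2.
apply: norm_cvg0.
apply: (@squeeze_cvgr _ _ _ _ (cst 0)
  (fun p : E * E => dual_norm (D p.1) * `|p.2|)).
- by apply: nearW => p; rewrite normr_ge0/=; exact: dual_normP.
- exact: cvg_cst.
rewrite -(mul0r `|v|); apply: cvgM.
  apply: (@cvg_comp _ _ _ fst (fun w => dual_norm (D w)) _ (nbhs u)).
    exact: cvg_fst.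
  exact: cdf.
apply: cvg_norm; exact: cvg_snd.
Qed.

Lemma is_derive_line f u v (t : R) : differentiable f (u + t *: v) ->
  is_derive t (1 : R) (fun s : R => f (u + s *: v)) ('d f (u + t *: v) v).
Proof.
move=> df.
have h : is_diff t (fun s : R => u + s *: v) (fun s : R => s *: v).
  apply: is_diff_eq.
  exact: add0r.
have hc := is_diff_comp h (differentiableP df).
apply: DeriveDef; first exact: diff_derivable.
by rewrite deriveE// diff_val /= scale1r.
Qed.

Lemma is_derive_ray f u (t : R) : differentiable f (t *: u) ->
  is_derive t (1 : R) (fun s : R => f (s *: u)) ('d f (t *: u) u).
Proof.
move=> df; have := is_derive_line f 0 u t; rewrite add0r => /(_ df).
by under eq_fun do rewrite add0r.
Qed.

Lemma is_diff_quadratic (a : {bilinear E -> E -> R^o}) u :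
  continuous (fun p : E * E => a p.1 p.2) -> (forall u v, a u v = a v u) ->
  is_diff u (fun u : E => a u u : R^o) (fun v => 2 * a u v : R^o).
Proof.
move=> ca sa.
have hp : is_diff u (fun u : E => (u, u)) (fun v => (v, v)).
  exact: is_diff_pair.
have hb : is_diff (u, u) (fun p : E * E => a p.1 p.2 : R^o)
    (fun q => a u q.2 + a q.1 u : R^o).
  by apply: DiffDef; [exact: differentiable_bilin | exact: diff_bilin].
have := is_diff_comp hp hb; rewrite /comp/= => h.
apply: is_diff_eq h _; apply/funext => v /=.
by rewrite (sa v u) mulr_natl mulr2n.
Qed.

End C1Functionals.

(** * Descent fields along a segment and the deformation they produce *)

Section DescentPath.
Context {R : realType} {E : normedModType R}.

Lemma continuous_sum_bumps (l : seq R) (r : R -> R) (v : R -> E) :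
  continuous (fun s : R => \sum_(i <- l) Num.max 0 (r i - `|s - i|) *: v i).
Proof.
elim: l => [|i l IH].
  by under eq_fun do rewrite big_nil; exact: cst_continuous.
under eq_fun do rewrite big_cons.
move=> s; apply: cvgD; last exact: IH.
apply: cvgZ; last exact: cvg_cst.
apply: (@continuous_max _ _ (cst 0) (fun s => r i - `|s - i|)).
  exact: cvg_cst.
apply: cvgB; first exact: cvg_cst.
by apply: cvg_norm; apply: cvgB; [exact: cvg_id | exact: cvg_cst].
Qed.

(* The weights max(0, r_i - |s - i|) need not be normalised: the sum is negative
   as soon as one of them is positive. *)
Lemma continuous_descent_field (D : R -> E -> R^o) (x y : R) :
  (forall s, linear (D s)) -> (forall v, continuous (D ^~ v)) ->
  (forall s, x <= s <= y -> exists v, D s v < 0) ->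
  exists V : R -> E, continuous V /\ forall s, x <= s <= y -> D s (V s) < 0.
Proof.
move=> lD cD hD.
(* Each [p s] pairs a descent direction at [s] with a radius on which it remains one; outside
   [[x, y]] the pair is arbitrary. *)
have /choice[p hp] : forall s, exists p : E * R, x <= s <= y ->
    0 < p.2 /\ forall t, `|t - s| < p.2 -> D t p.1 < 0.
  move=> s; have [sxy|] := pselect (x <= s <= y); last by exists (0, 0).
  have [v Dv] := hD s sxy.
  have nDv : \forall t \near s, D t v < 0 by exact: (cvgr_lt _ (cD v s)).
  have /nbhs_ballP[e /= e0 he] := nDv.
  exists (v, e) => _; split=> // t ts; apply: he.
  by rewrite /ball/= distrC.
have := @segment_compact R x y; rewrite compact_cover.
move=> /(_ R `[x, y]%classic (fun s => ball s (p s).2)) [].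
- move=> i; rewrite /= in_itv/= => ixy.
  by apply: ball_open; exact: (hp i ixy).1.
- move=> s sxy; exists s => //; apply: ballxx; apply: (hp s _).1.
  by move: sxy; rewrite /= in_itv.
move=> k kxy kcov; pose l : seq R := finmap.enum_fset k.
have lxy i : i \in l -> x <= i <= y.
  by move=> il; have := kxy i il; rewrite inE/= in_itv.
pose w i s := Num.max 0 ((p i).2 - `|s - i|).
exists (fun s => \sum_(i <- l) w i s *: (p i).1); split.
  exact: (continuous_sum_bumps l (fun i => (p i).2) (fun i => (p i).1)).
move=> s sxy.
have [fL fE] := linear_fun_pack (lD s).
have wle i : i \in l -> w i s * D s (p i).1 <= 0.
  move=> /lxy ixy.
  rewrite /w; have [h|h] := ltP 0 ((p i).2 - `|s - i|); last by rewrite mul0r.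
  by rewrite nmulr_lle0 ?(ltW h)// (hp i ixy).2// -subr_gt0.
have -> : D s (\sum_(i <- l) w i s *: (p i).1) =
    \sum_(i <- l) w i s * D s (p i).1.
  by rewrite -fE linear_sum/=; apply: eq_bigr => i _; rewrite linearZ.
have [i /= il si] : (\bigcup_(i in [set` l]) ball i (p i).2) s.
  by apply: kcov; rewrite /= in_itv.
have ixy := lxy i il.
have si' : `|s - i| < (p i).2 by move: si; rewrite /ball/= distrC.
rewrite (big_rem i)//= -[ltRHS]addr0 ltr_leD//.
  by rewrite nmulr_llt0 ?(hp i ixy).2// /w lt_max subr_gt0 si' orbT.
rewrite big_seq; apply: sumr_le0 => j jl; apply: wle; exact: mem_rem jl.
Qed.

(** Near each [(s0, 0)] the derivative in the direction [V s] stays negative, and the mean value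
    theorem in [t] gives the decrease; compactness of [[x, y]] makes the range of [t] uniform in
    [s]. *)
Lemma descent_path (f : E -> R^o) (u : E) (V : R -> E) (x y : R) :
  C1 f -> continuous V ->
  (forall s, x <= s <= y -> s *: u != 0 /\ 'd f (s *: u) (V s) < 0) ->
  \forall t \near 0^'+, forall s, x <= s <= y ->
    s *: u + t *: V s != 0 /\ f (s *: u + t *: V s) < f (s *: u).
Proof.
move=> C1f cV hV.
pose P (t s : R) := s *: u + t *: V s != 0 /\ f (s *: u + t *: V s) < f (s *: u).
suff : \forall t \near 0^'+, `[x, y]%classic `<=` P t.
  by apply: filterS => t h s sxy; apply: h; rewrite /= in_itv.
have /compact_near_coveringP := @segment_compact R x y; apply => s0.
rewrite /= in_itv/= => /hV [su0 ds0].
pose line (p : R * R) : E := p.1 *: u + p.2 *: V p.1.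
have cVp : continuous (fun p : R * R => V p.1).
  by move=> p; apply: continuous_comp; [exact: cvg_fst | exact: cV].
have cline : continuous line.
  move=> p; apply: cvgD; first by apply: cvgZ; [exact: cvg_fst | exact: cvg_cst].
  by apply: cvgZ; [exact: cvg_snd | exact: cVp].
have cG : continuous (fun p : R * R => 'd f (line p) (V p.1) : R^o).
  move=> p; apply: (@continuous_comp _ _ _ (fun p => (line p, V p.1))
    (fun q : E * E => 'd f (q.1) (q.2) : R^o)).
    by apply: cvg_pair; [exact: cline | exact: cVp].
  exact: C1_diff_continuous.
have line0 : line (s0, 0) = s0 *: u by rewrite /line/= scale0r addr0.
have n0 : \forall p \near (s0, 0 : R), 0 < `|line p|.
  apply: (cvgr_gt _ (cvg_norm (cline (s0, 0)))).
  by rewrite normr_gt0 line0.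
have d0 : \forall p \near (s0, 0 : R), 'd f (line p) (V p.1) < 0.
  apply: (cvgr_lt _ (cG (s0, 0))); by rewrite line0.
have [e /= e0 he] : exists2 e : R, 0 < e &
    forall s t, `|s - s0| < e -> `|t| < e ->
    0 < `|line (s, t)| /\ 'd f (line (s, t)) (V s) < 0.
  have nd : \forall p \near (s0, 0 : R),
      0 < `|line p| /\ 'd f (line p) (V p.1) < 0 by exact: filterI.
  have /nbhs_ballP[e /= e0 he] := nd.
  exists e => // s t se te; apply: (he (s, t)).
  by split; rewrite /ball/= ?sub0r ?normrN// distrC.
near=> s t => /=.
have se : `|s - s0| < e.
  by near: s; apply: (@cvgr_distC_lt _ _ _ _ _ id s0 cvg_id).
have t0 : 0 < t by near: t; exact: nbhs_right_gt.
have te : t < e by near: t; exact: nbhs_right_lt.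
split; first by rewrite -normr_gt0; have [] := he s t se; rewrite ?gtr0_norm.
have dl (r : R) : is_derive r (1 : R) (fun t : R => f (s *: u + t *: V s))
    ('d f (s *: u + r *: V s) (V s)).
  by apply: is_derive_line; exact: C1f.1.
have cl : {within `[0, t], continuous (fun t : R => f (s *: u + t *: V s))}.
  apply: continuous_subspaceT => r; apply: differentiable_continuous.
  by apply/derivable1_diffP; have [] := dl r.
have [c] := MVT t0 (fun r _ => dl r) cl.
rewrite in_itv/= scale0r addr0 subr0 => /andP[c0 ct] eqc.
rewrite -subr_lt0 eqc nmulr_rlt0//.
by have [] := he s c se; rewrite // gtr0_norm// (lt_trans ct).
Unshelve. all: by end_near. Qed.

End DescentPath.

(** The hypothesis says that [f (s *: v) / s] has a nonnegative derivative; its values at [1] and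
    [t] are compared. *)
Lemma euler_ineq_superlinear {R : realType} {E : normedModType R}
    (f : E -> R^o) (v : E) (t : R) :
  (forall s : R, 0 < s -> differentiable f (s *: v)) ->
  (forall s : R, 0 < s -> f (s *: v) <= 'd f (s *: v) (s *: v)) ->
  1 <= t -> t * f v <= f (t *: v).
Proof.
move=> df hf; rewrite le_eqVlt => /predU1P[<-|t1]; first by rewrite mul1r scale1r.
pose dq s := f (s *: v) * (- s ^- 2) + s^-1 * 'd f (s *: v) v.
have Dq (s : R) : 0 < s ->
    is_derive s (1 : R) (fun s : R => f (s *: v) * s^-1) (dq s).
  move=> s0; have hb := is_derive_ray f v s (df s s0).
  have hi : is_derive s (1 : R) (fun s : R => s^-1) (- s ^- 2).
    apply: DeriveDef.
      by apply: derivableV; [rewrite gt_eqF | exact: derivable_id].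
    rewrite deriveV; [|by rewrite gt_eqF | exact: derivable_id].
    by rewrite derive_id /GRing.scale/= mulr1.
  exact: (is_deriveM hb hi).
have cq : {within `[1, t], continuous (fun s : R => f (s *: v) * s^-1)}.
  apply: derivable_within_continuous => s; rewrite in_itv/= => /andP[s1 _].
  by have [] := Dq s (lt_le_trans ltr01 s1).
have Dq1 (s : R) : s \in `]1, t[ ->
    is_derive s (1 : R) (fun s : R => f (s *: v) * s^-1) (dq s).
  by rewrite in_itv/= => /andP[s1 _]; exact/Dq/(lt_trans ltr01 s1).
have [s] := MVT t1 Dq1 cq.
rewrite in_itv/= => /andP[s1 st]; rewrite invr1 scale1r mulr1 => eqs.
have s0 : 0 < s by exact: lt_trans s1.
have t0 : 0 < t by exact: lt_trans t1.
rewrite mulrC -ler_pdivlMr// -subr_ge0 eqs pmulr_lge0 ?subr_gt0//.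
have := hf s s0; rewrite linearZ/= /GRing.scale/= => fs.
have -> : dq s = s ^- 2 * (s * 'd f (s *: v) v - f (s *: v)).
  by rewrite /dq; field; rewrite gt_eqF.
by rewrite pmulr_rge0 ?subr_ge0// invr_gt0 exprn_gt0.
Qed.

Section Minimiser.
Context {R : realType} {E : normedModType R}.

Lemma limn_einf_le_lim (x y : nat -> R) (l : R) :
  (forall k, x k <= y k) -> y k @[k --> \oo] --> l ->
  (limn_einf (fun k => (x k)%:E) <= l%:E)%E.
Proof.
move=> xy yl.
have /cvg_limn_einf_sup[<- _] : (y k)%:E @[k --> \oo] --> l%:E.
  by apply: cvg_EFin => //; exact: nearW.
rewrite !limn_einf_lim; apply: lee_lim; [exact: is_cvg_einfs|exact: is_cvg_einfs|].
apply: nearW => n; apply/ereal_infP => _ [k nk <-].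
apply: le_trans (ereal_inf_lbound _) _; first by exists k.
by rewrite lee_fin.
Qed.

Lemma weak_cvgZ (s : R) (u : nat -> E) (e : E) :
  weak_cvg u e -> weak_cvg (fun k => s *: u k) (s *: e).
Proof.
move=> ue f df; have [fL fE] := linear_fun_pack df.1.
rewrite -fE linearZ /= fE.
under eq_fun do rewrite -fE linearZ /= fE.
by apply: cvgZ; [exact: cvg_cst | exact: ue].
Qed.

End Minimiser.

(** * Geometry of the rays and of the Nehari set *)

Section Nehari.
Context {R : realType} {E : normedModType R}.
Context (a : {bilinear E -> E -> R^o}) (Phi b : E -> R^o).
Context (C1_Phi : C1 Phi)
  (PhiE : forall u : E, Phi u = 2^-1 * a u u + b u)
  (a_cont : continuous (fun p : E * E => a p.1 p.2))
  (a_sym : forall u v : E, a u v = a v u)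
  (b0 : b 0 = 0)
  (b_at0 : b u / `|u| ^+ 2 @[u --> (0 : E)^'] --> +oo)
  (b_infty : b u / `|u| ^+ 2 @[u --> norm_infty E] --> (0 : R))
  (b_pos : forall u : E, u <> 0 -> b u <= 'd b u u /\ 0 < b u)
  (b_slope : forall u : E, u <> 0 -> forall s t : R, 0 < s -> s <= t ->
    'd b (t *: u) u / t <= 'd b (s *: u) u / s).
Implicit Types (u v : E).

Lemma is_diff_b u : is_diff u b (fun v => 'd Phi u v - a u v).
Proof.
have -> : b = Phi - 2^-1 *: (fun u => a u u : R^o).
  by apply/funext => w; rewrite !fctE PhiE addrAC [_ *: _]/(_ * _) subrr add0r.
have hPhi : is_diff u Phi ('d Phi u) by apply: differentiableP; exact: C1_Phi.1.
have ha := is_diff_quadratic a u a_cont a_sym.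
apply: is_diff_eq; apply/funext => v; rewrite !fctE /GRing.scale/=.
by rewrite mulrA mulVf ?mul1r.
Qed.

Lemma quadZ s u : a (s *: u) (s *: u) = s ^+ 2 * a u u.
Proof. by rewrite linearZl_LR linearZr/= /GRing.scale/= mulrA expr2. Qed.

Lemma diff_PhiE u v : 'd Phi u v = a u v + 'd b u v.
Proof. by have /@diff_val -> := is_diff_b u; rewrite addrC subrK. Qed.

(** Once [s] is factored out, the sign of the derivative along the ray is that of a non-increasing
    function of [s], by [b_slope]. *)
Lemma diff_Phi_ray u s : 0 < s ->
  'd Phi (s *: u) u = s * (a u u + 'd b (s *: u) u / s).
Proof.
move=> s0; rewrite diff_PhiE linearZl_LR/= mulrDr; congr (_ + _).
by rewrite mulrC divfK// lt0r_neq0.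
Qed.

Lemma continuous_ray u : continuous (fun s : R => Phi (s *: u)).
Proof.
move=> s; apply: differentiable_continuous; apply/derivable1_diffP.
by have [] := is_derive_ray Phi u s (C1_Phi.1 _).
Qed.

Lemma MVT_ray u (s t : R) : s < t ->
  exists2 c, s < c < t & Phi (t *: u) - Phi (s *: u) = 'd Phi (c *: u) u * (t - s).
Proof.
move=> st.
have [c] := MVT st (fun r _ => is_derive_ray Phi u r (C1_Phi.1 _))
  (continuous_subspaceT (continuous_ray u)).
by rewrite in_itv/= => cst eqc; exists c.
Qed.

Lemma Phi0 : Phi 0 = 0.
Proof. by rewrite PhiE b0 linear0l mulr0 addr0. Qed.

(** The non-increasing factor of the derivative along the ray vanishes at 1, so [Phi] does not
    decrease before 1 and does not increase after it. *)
Lemma nehari_ray_max u s : nehari Phi u -> 0 <= s -> Phi (s *: u) <= Phi u.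
Proof.
move=> [u0 du0] s0.
have d1 : a u u + 'd b (1 *: u) u / 1 = 0.
  by rewrite -[LHS]mul1r -diff_Phi_ray// scale1r.
have <- : Phi (1 *: u) = Phi u by rewrite scale1r.
have [s1|s1|->//] := ltrgtP s 1.
  have [c /andP[sc c1] eqc] := MVT_ray u s 1 s1.
  have c0 : 0 < c by exact: le_lt_trans sc.
  rewrite -subr_ge0 eqc diff_Phi_ray// -mulrA pmulr_rge0//.
  by rewrite pmulr_lge0 ?subr_gt0// -[leLHS]d1 lerD2l b_slope// ltW.
have [c /andP[c1 cs] eqc] := MVT_ray u 1 s s1.
have c0 : 0 < c by exact: lt_trans c1.
rewrite -subr_le0 eqc diff_Phi_ray// -mulrA pmulr_rle0//.
by rewrite pmulr_lle0 ?subr_gt0// -[leRHS]d1 lerD2l b_slope// ltW.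
Qed.

Lemma nehari_Pneg u : nehari Phi u -> Pneg a u.
Proof.
move=> [u0 /eqP]; rewrite diff_PhiE addr_eq0 => /eqP auu.
have [bu bu0] := b_pos u u0.
by rewrite /Pneg/= auu oppr_lt0 (lt_le_trans bu0).
Qed.

(** Near 0, [b] exceeds [k * |v|^2], where [k] bounds the form [a]; half of this compensates the
    quadratic part of [Phi], and the other half is [m]. *)
Lemma sphere_lower_bound : exists (r m : R), [/\ 0 < r, 0 < m &
  forall v, `|v| = r -> m <= Phi v /\ m <= b v].
Proof.
have [k k0 ak] := bilinear_schwarz a_cont.
have : \forall u \near (0 : E)^', k < b u / `|u| ^+ 2.
  by have /cvgryPgt := b_at0; apply.
rewrite near_withinE => /nbhs_norm0P[e /= e0 he].
have r0 : 0 < e / 2 by rewrite divr_gt0.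
exists (e / 2), (2^-1 * (k * (e / 2) ^+ 2)).
have m0 : 0 < k * (e / 2) ^+ 2 by rewrite mulr_gt0// exprn_gt0.
split=> //; first by rewrite mulr_gt0 ?invr_gt0.
move=> v vr.
have bv : k * (e / 2) ^+ 2 < b v.
  have := he v; rewrite /= vr ltr_pdivlMr ?exprn_gt0//; apply.
    by rewrite ltr_pdivrMr// ltr_pMr// ltr1n.
  by rewrite -normr_gt0 vr.
have := ak v v; rewrite vr -mulrA -expr2 ler_norml => /andP[av _].
by rewrite PhiE; split; lra.
Qed.

Lemma Pneg_neq0 u : Pneg a u -> u <> 0.
Proof. by move=> + u0; rewrite /Pneg/= u0 linear0l ltxx. Qed.

Lemma Pneg_ray_lt0 u : Pneg a u ->
  exists2 S, 0 < S & forall s, S <= s -> Phi (s *: u) < 0.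
Proof.
move=> au; have /eqP u0 := Pneg_neq0 u au; rewrite /Pneg/= in au.
have nu : 0 < `|u| by rewrite normr_gt0.
(* With this [d] the quadratic part of [Phi (s *: u)] is [- d * |s *: u|^2], which dominates [b] far
   from 0. *)
pose d := - a u u / (2 * `|u| ^+ 2).
have d0 : 0 < d by rewrite divr_gt0 ?oppr_gt0// mulr_gt0// exprn_gt0.
have : \forall v \near norm_infty E, b v / `|v| ^+ 2 < d.
  exact: (cvgr_lt _ b_infty).
move=> [M _ hM].
exists ((`|M| + 1) / `|u|) => [|s Ss]; first by rewrite divr_gt0// ltr_wpDl.
have s0 : 0 < s by apply: lt_le_trans Ss; rewrite divr_gt0// ltr_wpDl.
have nsu : `|s *: u| = s * `|u| by rewrite normrZ gtr0_norm.
have : b (s *: u) / `|s *: u| ^+ 2 < d.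
  apply: hM; rewrite /= nsu; move: Ss; rewrite ler_pdivrMr//.
  by apply: lt_le_trans; rewrite (le_lt_trans (ler_norm M))// ltrDl.
rewrite nsu ltr_pdivrMr ?exprn_gt0 ?mulr_gt0// => bs.
rewrite PhiE quadZ.
have -> : 2^-1 * (s ^+ 2 * a u u) = - (d * (s * `|u|) ^+ 2).
  by rewrite /d; field; rewrite gt_eqF.
by rewrite addrC subr_lt0.
Qed.

(** On the ray, [Phi] is 0 at the origin, positive at norm [r] and negative from [S] on, so its
    maximum over [[0, S]] is interior. *)
Lemma Pneg_ray_nehari u : Pneg a u -> exists2 s, 0 < s & nehari Phi (s *: u).
Proof.
move=> au; have u0 := Pneg_neq0 u au; have /eqP u0' := u0.
have nu : 0 < `|u| by rewrite normr_gt0.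
have [S S0 hS] := Pneg_ray_lt0 u au.
have [r [m [r0 m0 hr]]] := sphere_lower_bound.
have Phir : 0 < Phi ((r / `|u|) *: u).
  apply: lt_le_trans m0 _; apply: (hr _ _).1.
  by rewrite normrZ gtr0_norm ?divr_gt0// divfK// lt0r_neq0.
have [c] := EVT_max (ltW S0) (continuous_subspaceT (continuous_ray u)).
rewrite in_itv/= => /andP[c0 cS] hc.
have Phic : 0 < Phi (c *: u).
  apply: (lt_le_trans Phir); apply: hc.
  rewrite in_itv/= (divr_ge0 (ltW r0) (ltW nu))/=.
  by rewrite leNgt; apply/negP => /ltW/hS; rewrite ltNge ltW.
have {}c0 : 0 < c.
  rewrite lt_def c0 andbT; apply: contraTneq Phic => ->.
  by rewrite scale0r Phi0 ltxx.
have {}cS : c < S.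
  by rewrite ltNge; apply/negP => /hS; rewrite ltNge ltW.
exists c => //; split.
  by move=> /eqP; rewrite scaler_eq0 (gt_eqF c0)/= => /eqP.
have dc : 'd Phi (c *: u) u = 0.
  have h1 := is_derive_ray Phi u c (C1_Phi.1 _).
  have h2 : is_derive c (1 : R) (fun s : R => Phi (s *: u)) 0.
    apply: (derive1_at_max (ltW S0)); last first.
    - move=> t; rewrite in_itv/= => /andP[t0 tS].
      by apply: hc; rewrite in_itv/= !ltW.
    - by rewrite in_itv/= c0.
    - by move=> t _; have [] := is_derive_ray Phi u t (C1_Phi.1 _).
  by case: h1 => _ <-; case: h2.
by rewrite linearZ/= dc scaler0.
Qed.

Lemma nehari_maximums u s : 0 < s -> nehari Phi (s *: u) ->
  maximums (ray_values Phi u) (Phi (s *: u)).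
Proof.
move=> s0 Nsu; split; first by exists s => //=; exact: ltW.
move=> _ [t /= t0 <-]; have -> : t *: u = (t / s) *: (s *: u).
  by rewrite scalerA divfK// lt0r_neq0.
by apply: nehari_ray_max => //; rewrite divr_ge0// ltW.
Qed.

Lemma max_valueE (A : set R) m : maximums A m -> max_value A = m.
Proof.
move=> [Am ubm]; have [AM ubM] : maximums A (max_value A).
  by apply: getPex; exists m.
by apply/eqP; rewrite eq_le ubm// ubM.
Qed.

(** Normalising the points of the Nehari set gives the unit vectors of [Sneg a], and conversely each
    such ray reaches its maximum on the Nehari set; the two infima thus range over one set of
    values. *)
Lemma max_values_nehari :
  [set max_value (ray_values Phi e) | e in Sneg a] = Phi @` nehari Phi.
Proof.
rewrite eqEsubset; split=> [_ [e [e1 ae] <-]|_ [u Nu <-]].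
  have [s s0 Ns] := Pneg_ray_nehari e ae.
  by exists (s *: e) => //; rewrite (max_valueE _ _ (nehari_maximums e s s0 Ns)).
have /eqP u0 := Nu.1; have nu : 0 < `|u| by rewrite normr_gt0.
have uE : `|u| *: (`|u|^-1 *: u) = u by rewrite scalerA divff ?scale1r// lt0r_neq0.
exists (`|u|^-1 *: u).
  split; first by rewrite normrZ gtr0_norm ?invr_gt0// mulVf// lt0r_neq0.
  by rewrite quadZ pmulr_rlt0 ?exprn_gt0 ?invr_gt0//; exact: nehari_Pneg.
have := nehari_maximums (`|u|^-1 *: u) `|u| nu; rewrite uE => /(_ Nu).
exact: max_valueE.
Qed.

Lemma nehari_lower_bound : exists2 m, 0 < m & forall u, nehari Phi u -> m <= Phi u.
Proof.
have [r [m [r0 m0 hr]]] := sphere_lower_bound; exists m => // u Nu.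
have /eqP u0 := Nu.1; have nu : 0 < `|u| by rewrite normr_gt0.
apply: le_trans (nehari_ray_max u (r / `|u|) Nu _); last by rewrite divr_ge0// ltW.
by apply: (hr _ _).1; rewrite normrZ gtr0_norm ?divr_gt0// divfK// lt0r_neq0.
Qed.

Lemma b_superlinear v t : v <> 0 -> 1 <= t -> t * b v <= b (t *: v).
Proof.
move=> v0; apply: euler_ineq_superlinear => s s0.
  by have [] := is_diff_b (s *: v).
by apply: (b_pos _ _).1 => /eqP; rewrite scaler_eq0 (gt_eqF s0)/= => /eqP.
Qed.

(** * Minimisation over the Nehari set and criticality *)

Lemma nehari_minimiser :
  reflexive_space E -> weakly_continuous (fun u => a u u) ->
  weakly_lower_semicontinuous b -> Pneg a !=set0 ->
  exists2 u, nehari Phi u & forall w, nehari Phi w -> Phi u <= Phi w.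
Proof.
move=> hE wa wb [u0 au0].
have [s0 _ Ns0] := Pneg_ray_nehari u0 au0.
have [m m0 hm] := nehari_lower_bound.
pose c := inf (Phi @` nehari Phi).
have hinf : has_inf (Phi @` nehari Phi).
  split; first by exists (Phi (s0 *: u0)), (s0 *: u0).
  by exists m => _ [w Nw <-]; exact: hm.
have cle w : nehari Phi w -> c <= Phi w.
  by move=> Nw; apply: ge_inf; [exact: hinf.2 | exists w].
have /choice[u hu] : forall n : nat, exists u, nehari Phi u /\ Phi u < c + n.+1%:R^-1.
  move=> n; have n0 : 0 < n.+1%:R^-1 :> R by rewrite invr_gt0.
  by have [_ [u Nu <-] ltu] := inf_adherent n0 hinf; exists u.
have nu n : 0 < `|u n| by rewrite normr_gt0; apply/eqP; exact: (hu n).1.1.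
pose e n := `|u n|^-1 *: u n.
have e1 n : `|e n| = 1 by rewrite normrZ gtr0_norm ?invr_gt0// mulVf// gt_eqF.
have e1le n : `|e n| <= 1 by rewrite e1.
have [n [z [nk ez]]] := reflexive_weak_subsequence e 1 hE e1le.
pose w k := e (n k).
have awz : a (w k) (w k) @[k --> \oo] --> a z z by exact: wa.
have aw0 k : a (w k) (w k) < 0.
  rewrite quadZ pmulr_rlt0; first exact: nehari_Pneg (hu _).1.
  by rewrite exprn_gt0// invr_gt0.
(* The whole ray of [w k] lies below its Nehari point [u (n k)]; [k <= n k] is all that is needed of
   the subsequence. *)
have Phiw s k : 0 <= s -> Phi (s *: w k) <= c + k.+1%:R^-1.
  move=> s0'; apply: (@le_trans _ _ (Phi (u (n k)))).
    by rewrite scalerA; apply: nehari_ray_max; [exact: (hu _).1 | rewrite divr_ge0].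
  apply: le_trans (ltW (hu (n k)).2) _; rewrite lerD2l lef_pV2 ?posrE//.
  by rewrite ler_nat ltnS.
(* This majorant of [b (s *: w k)] converges, by weak continuity of the quadratic form. *)
pose B s k := c + k.+1%:R^-1 - 2^-1 * (s ^+ 2 * a (w k) (w k)).
have Bcvg s : B s k @[k --> \oo] --> c - 2^-1 * (s ^+ 2 * a z z).
  apply: cvgB.
    rewrite -[X in _ --> X]addr0; apply: cvgD; first exact: cvg_cst.
    exact: cvg_harmonic.
  by apply: cvgM; [exact: cvg_cst | apply: cvgM => //; exact: cvg_cst].
have bw s k : 0 <= s -> b (s *: w k) <= B s k.
  by move=> s0'; rewrite /B lerBrDl -quadZ -PhiE Phiw.
(* If a z z = 0, then b grows linearly along the rays of the w k, starting from
   the sphere of radius r, while it is asymptotically at most c. *)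
have azz : a z z < 0.
  have [r [d [r0 d0 hrd]]] := sphere_lower_bound.
  rewrite ltNge; apply/negP => az0.
  (* Chosen so that [t * d = d + |c|], which exceeds [c]. *)
  pose t := 1 + `|c| / d.
  have t1 : 1 <= t by rewrite lerDl divr_ge0// ltW.
  have tr0 : 0 <= t * r by rewrite mulr_ge0 ?(ltW r0)//; lra.
  have : t * d <= c - 2^-1 * ((t * r) ^+ 2 * a z z).
    apply: (closed_cvg (fun x => t * d <= x) _ _ _ (Bcvg (t * r))).
      exact: closed_ge.
    apply: nearW => k; apply: le_trans (bw _ k tr0).
    rewrite -scalerA; apply: le_trans (b_superlinear (r *: w k) t _ t1).
      rewrite ler_wpM2l//; first by lra.
      by apply: (hrd _ _).2; rewrite normrZ e1 mulr1 gtr0_norm.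
    by move=> /eqP; rewrite -normr_eq0 normrZ e1 mulr1 gtr0_norm// gt_eqF.
  have : 0 <= (t * r) ^+ 2 * a z z by rewrite mulr_ge0// exprn_ge0.
  have : t * d = d + `|c| by rewrite /t mulrDl mul1r divfK// gt_eqF.
  by have := ler_norm c; lra.
have [s s1 Ns] := Pneg_ray_nehari z azz.
exists (s *: z) => // v /cle; apply: le_trans.
(* Lower semicontinuity bounds [b (s *: z)] by the limit of [B s k], which amounts to
   [Phi (s *: z) <= c]. *)
have := wb _ _ (weak_cvgZ s w z ez).
have /(limn_einf_le_lim _ _ _ (fun k => bw s k (ltW s1))) := Bcvg s.
move=> h1 h2; have := le_trans h2 h1.
by rewrite lee_fin lerBrDl -quadZ -PhiE.
Qed.

(* The ray through u may meet the Nehari set along a whole segment, and u itself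
   need not be critical. If no point s u is, the ray can be pushed below the
   level Phi u near that segment, and still has to cross the Nehari set. *)
Lemma nehari_minimiser_critical u : nehari Phi u ->
  (forall w, nehari Phi w -> Phi u <= Phi w) ->
  exists2 s, 0 < s & critical_point Phi (s *: u).
Proof.
move=> Nu umin; have [m m0 hm] := nehari_lower_bound.
have Phiu : 0 < Phi u := lt_le_trans m0 (hm u Nu).
(* Since [Phi] rises from 0 to [Phi u > 0] and is eventually negative, the ray has points
   [x < 1 < y] with derivatives of opposite strict signs. *)
have [x /andP[x0 x1] dx] : exists2 x : R, 0 < x < 1 & 0 < 'd Phi (x *: u) u.
  have [x x01 eqx] := MVT_ray u 0 1 ltr01; exists x => //.
  by move: eqx; rewrite scale1r scale0r Phi0 !subr0 mulr1 => <-.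
have [y y1 dy] : exists2 y : R, 1 < y & 'd Phi (y *: u) u < 0.
  have [S S0 hS] := Pneg_ray_lt0 u (nehari_Pneg u Nu).
  have S1 : 1 < S.
    rewrite ltNge; apply/negP => /hS.
    by rewrite scale1r ltNge ltW.
  have [y /andP[y1 _] eqy] := MVT_ray u 1 S S1; exists y => //.
  have : Phi (S *: u) - Phi (1 *: u) < 0.
    by rewrite scale1r subr_lt0; apply: lt_trans Phiu; exact: hS.
  by rewrite eqy pmulr_llt0 ?subr_gt0.
have xy : x <= y by rewrite ltW// (lt_trans x1).
apply: contrapT => ncrit.
have hD (s : R) : x <= s <= y -> exists v, 'd Phi (s *: u) v < 0.
  move=> /andP[xs _]; apply: contrapT => hv; apply: ncrit.
  exists s; first exact: lt_le_trans xs.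
  move=> v; apply/eqP; rewrite eq_le; apply/andP.
  split; rewrite leNgt; apply/negP => h.
    by apply: hv; exists (- v); rewrite linearN oppr_lt0.
  by apply: hv; exists v.
have cdPhi := C1_diff_continuous Phi C1_Phi.
have [V [cV dV]] : exists V : R -> E, continuous V /\
    forall s, x <= s <= y -> 'd Phi (s *: u) (V s) < 0.
  apply: continuous_descent_field hD => [s k v w|v s]; first exact: linearP.
  apply: (@continuous_comp _ _ _ (fun s : R => (s *: u, v))
    (fun q : E * E => 'd Phi (q.1) (q.2) : R^o)); last exact: cdPhi.
  by apply: cvg_pair; [exact: scalel_continuous | exact: cvg_cst].
have /eqP u0 := Nu.1.
have hV s : x <= s <= y -> s *: u != 0 /\ 'd Phi (s *: u) (V s) < 0.
  move=> sxy; split; last exact: dV.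
  rewrite scaler_eq0 (negbTE u0) orbF gt_eqF//.
  by case/andP: sxy => xs _; exact: lt_le_trans xs.
pose psi (w : E) : R := 'd Phi w w.
have cpsi : continuous psi.
  move=> w; apply: (@continuous_comp _ _ _ (fun w : E => (w, w))
    (fun q : E * E => 'd Phi (q.1) (q.2) : R^o)); last exact: cdPhi.
  by apply: cvg_pair; exact: cvg_id.
have ct s : psi (s *: u + t *: V s) @[t --> 0^'+] --> psi (s *: u).
  apply: cvg_at_right_filter.
  rewrite -[X in _ --> psi X](_ : s *: u + 0 *: V s = _); last first.
    by rewrite scale0r addr0.
  apply: (@continuous_comp _ _ _ (fun t : R => s *: u + t *: V s) psi).
    by apply: cvgD; [exact: cvg_cst | exact: scalel_continuous].
  exact: cpsi.
have near_t : \forall t \near (0 : R)^'+,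
    [/\ 0 < psi (x *: u + t *: V x), psi (y *: u + t *: V y) < 0 &
    forall s, x <= s <= y -> s *: u + t *: V s != 0 /\
      Phi (s *: u + t *: V s) < Phi (s *: u)].
  have n1 : \forall t \near (0 : R)^'+, 0 < psi (x *: u + t *: V x).
    by apply: (cvgr_gt _ (ct x)); rewrite /psi linearZ/= mulr_gt0.
  have n2 : \forall t \near (0 : R)^'+, psi (y *: u + t *: V y) < 0.
    apply: (cvgr_lt _ (ct y)); rewrite /psi linearZ/= pmulr_rlt0//.
    exact: lt_trans y1.
  by apply: filterS3 n1 n2 (descent_path Phi u V x y C1_Phi cV hV) => t *; split.
have [t [t1 t2 t3]] := filter_ex near_t.
(* The deformed path keeps the signs of [psi] at its ends and avoids 0, so it meets the Nehari set,
   at a level below [Phi (s *: u) <= Phi u]: a contradiction. *)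
have [||s sxy psis] := @IVT R (fun s => psi (s *: u + t *: V s)) x y 0 xy.
- apply: continuous_subspaceT => s.
  apply: (@continuous_comp _ _ _ (fun s : R => s *: u + t *: V s) psi).
    apply: cvgD; first exact: scalel_continuous.
    by apply: cvgZ; [exact: cvg_cst | exact: cV].
  exact: cpsi.
- by rewrite ge_min le_max (ltW t2) (ltW t1) orbT.
rewrite in_itv/= in sxy; have [/eqP w0 wlt] := t3 s sxy.
have s0 : 0 <= s by case/andP: sxy => xs _; rewrite ltW// (lt_le_trans x0).
have := umin (s *: u + t *: V s) (conj w0 psis).
by rewrite leNgt (lt_le_trans wlt)// nehari_ray_max.
Qed.

End Nehari.

Theorem theorem2p2 (R : realType) (E : completeNormedModType R)
  (hE : reflexive_space E)
  (a : {bilinear E -> E -> R^o}) (Phi b : E -> R^o)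
  (hPhi : C1 Phi)
  (hform : forall u : E, Phi u = 2^-1 * a u u + b u)
  (a_cont : continuous (fun p : E * E => a p.1 p.2))
  (a_sym : forall u v : E, a u v = a v u)
  (a_neg : Pneg a !=set0)
  (hi_a : weakly_continuous (fun u : E => a u u))
  (hi_b : weakly_lower_semicontinuous b)
  (hii_0 : b 0 = 0)
  (hii_zero : b u / `|u| ^+ 2 @[u --> (0 : E)^'] --> +oo)
  (hii_infty : b u / `|u| ^+ 2 @[u --> norm_infty E] --> (0 : R))
  (hiii : forall u : E, u <> 0 -> b u <= 'd b u u /\ 0 < b u)
  (hiv : forall u : E, u <> 0 -> forall s t : R, 0 < s -> s <= t ->
     'd b (t *: u) u / t <= 'd b (s *: u) u / s) :
  (forall e : E, Sneg a e -> maximums (ray_values Phi e) !=set0) /\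
  exists ubar : E,
    Pneg a ubar /\
    critical_point Phi ubar /\
    maximums (ray_values Phi ubar) (Phi ubar) /\
    (Phi ubar)%:E =
      ereal_inf [set (max_value (ray_values Phi e))%:E | e in Sneg a] /\
    (Phi ubar)%:E = ereal_inf [set (Phi u)%:E | u in nehari Phi] /\
    0 < Phi ubar.
Proof.
have rayN := Pneg_ray_nehari a Phi b hPhi hform a_cont hii_0 hii_zero hii_infty.
have Nmax := nehari_maximums a Phi b hPhi hform a_cont a_sym hiv.
split=> [e [_ ae]|].
  by have [s s0 Ns] := rayN e ae; exists (Phi (s *: e)); exact: Nmax.
have [u Nu umin] := nehari_minimiser a Phi b hPhi hform a_cont a_sym hii_0
  hii_zero hii_infty hiii hiv hE hi_a hi_b a_neg.
have [m m0 hm] := nehari_lower_bound a Phi b hPhi hform a_cont a_sym hii_zero hiv.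
have [s s0 crit] := nehari_minimiser_critical a Phi b hPhi hform a_cont a_sym
  hii_0 hii_zero hii_infty hiii hiv u Nu umin.
have Ns : nehari Phi (s *: u).
  split; last exact: crit.
  by move=> /eqP; rewrite scaler_eq0 gt_eqF//= => /eqP; exact: Nu.1.
(* Moving from [u] to the critical point [s *: u] on its ray does not raise [Phi], so the latter is
   a minimiser as well. *)
have smin w : nehari Phi w -> Phi (s *: u) <= Phi w.
  move=> /umin; apply: le_trans.
  exact: (nehari_ray_max a Phi b hPhi hform a_cont a_sym hiv u s Nu (ltW s0)).
have inf_s : (Phi (s *: u))%:E = ereal_inf [set (Phi u)%:E | u in nehari Phi].
  apply/eqP; rewrite eq_le; apply/andP; split.
    by apply/ereal_infP => _ [w Nw <-]; rewrite lee_fin smin.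
  by apply: ereal_inf_lbound; exists (s *: u).
exists (s *: u); split.
  exact: (nehari_Pneg a Phi b hPhi hform a_cont a_sym hiii).
split=> //; split.
  have := Nmax (s *: u) 1 ltr01; rewrite scale1r; exact.
split; last by split=> //; exact: lt_le_trans m0 (hm _ Ns).
rewrite inf_s -[in LHS]image_comp -[in RHS]image_comp.
congr (ereal_inf (EFin @` _)).
by rewrite (max_values_nehari a Phi b).
Qed.
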